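(* Let $E$ be a directed (real) ordered vector space endowed with an inner product $\langle\cdot,\cdot\rangle$, with induced norm $\|x\|=\sqrt{\langle x,x\rangle}$, and let $E^{+}=\{x\in E: 0\le x\}$ be its positive cone. Then the following assertions are equivalent. (i) $E$ is an inner product lattice; that is, $E$ (with its given order) is a vector lattice and the norm $\|\cdot\|$ induced by the inner product is a lattice norm. (ii) $E^{+}$ is a Chebyshev set in $E$, and the metric projection $P_{E^{+}}:E\to E^{+}$ is isotone (i.e. $P_{E^{+}}(x)\le P_{E^{+}}(y)$ whenever $x\le y$ in $E$) and subadditive (i.e. $P_{E^{+}}(x+y)\le P_{E^{+}}(x)+P_{E^{+}}(y)$ for all $x,y\in E$). Moreover, when these equivalent conditions hold, $P_{E^{+}}(x)=x^{+}$ for all $x\in E$.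
   Context: All vector spaces are real. No completeness of the norm is assumed. An ordered vector space is a real vector space with a partial order compatible with addition and with multiplication by nonnegative scalars. It is directed if for all $x,y\in E$ there is $z\in E$ with $x\le z$ and $y\le z$; equivalently, it is positively generated, i.e. every $x\in E$ can be written $x=y-z$ with $y,z\in E^{+}$. A vector lattice is an ordered vector space in which every pair $x,y$ has a supremum $x\vee y$; then $x^{+}=x\vee 0$, $x^{-}=(-x)\vee 0$ and $|x|=x\vee(-x)$. A norm on a vector lattice $E$ is a lattice norm if $|x|\le|y|$ in $E$ implies $\|x\|\le\|y\|$. A nonempty subset $A$ of a normed space $E$ is a Chebyshev set in $E$ if every $x\in E$ has a unique best approximation in $A$, i.e. a unique element $x^{\ast}\in A$ with $\|x-x^{\ast}\|=\inf\{\|x-a\|:a\in A\}$; this unique element is denoted $P_{A}(x)$, and the map $P_{A}$ is called the metric projection of $E$ onto $A$. *)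

(* Defs.v *)
From HB Require Import structures.
From mathcomp Require Import all_boot all_order all_algebra.
From mathcomp Require Import sesquilinear.
From mathcomp Require Import boolp classical_sets reals.

Set Implicit Arguments.
Unset Strict Implicit.
Unset Printing Implicit Defensive.

Import Order.TTheory GRing.Theory Num.Theory.
Local Open Scope classical_set_scope.
Local Open Scope ring_scope.

HB.mixin Record isOrderedLmodule (R : numDomainType) E
    of Num.POrderedZmodule E & GRing.Lmodule R E := {
  ov_leD2r : forall z x y : E, x <= y -> x + z <= y + z ;
  ov_leZ2l : forall (a : R) (x y : E), 0 <= a -> x <= y -> a *: x <= a *: y
}.

#[short(type="orderedLmodType")]
HB.structure Definition OrderedLmodule (R : numDomainType) :=
  { E of Num.POrderedZmodule E & GRing.Lmodule R E & isOrderedLmodule R E }.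

Section OrderedVectorSpace.
Variables (R : realType) (E : orderedLmodType R).
Implicit Types x y : E.

Definition directed : Prop :=
  forall x y, exists z : E, x <= z /\ y <= z.

Definition pos_cone : set E := [set x | 0 <= x].

Definition vector_lattice : Prop :=
  forall x y, supremums [set x; y] !=set0.

(* These are total functions; they return the default 0 when the supremum in
   question does not exist, so they are meaningful only in a vector lattice. *)
Definition vjoin x y : E := supremum 0 [set x; y].
Definition vpos x : E := vjoin x 0.
Definition vabs x : E := vjoin x (- x).

Definition lattice_norm (N : E -> R) : Prop :=
  forall x y, vabs x <= vabs y -> N x <= N y.

Definition isotone (f : E -> E) : Prop := {homo f : x y / x <= y}.

Definition subadditive (f : E -> E) : Prop :=
  forall x y, f (x + y) <= f x + f y.

End OrderedVectorSpace.

Section BestApproximation.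
Variables (R : realType) (E : lmodType R) (N : E -> R).

Definition best_approx (A : set E) (x : E) : set E :=
  [set b | A b /\ N (x - b) = inf [set N (x - a) | a in A]].

Definition chebyshev (A : set E) : Prop :=
  A !=set0 /\ forall x, exists! b, best_approx A x b.

(* Meaningful when A is a Chebyshev set; 0 is the default for points without a
   best approximation. *)
Definition metric_proj (A : set E) (x : E) : E := xget 0 (best_approx A x).

End BestApproximation.

Definition dot_norm (R : realType) (E : lmodType R)
    (dot : {dot E for (@idfun R)}) (x : E) : R := Num.sqrt (dot x x).

(* The norm induced by an inner product is always a norm, so only the order
   structure and the monotonicity of the norm have to be required. *)
Definition inner_product_lattice (R : realType) (E : orderedLmodType R)
    (dot : {dot E for (@idfun R)}) : Prop :=
  vector_lattice E /\ lattice_norm (dot_norm dot).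

(* Main.v *)
(** A point [p] of a convex cone [K] is the best approximation of [x] exactly
    when [x - p] is orthogonal to [p] and has nonpositive inner products with
    [K].  In an inner product lattice [x^+] satisfies these conditions:
    [| |x| | = |x|] gives orthogonality of [x^+] and [x^-], and
    [|a - b| <= a + b] gives [0 <= <a, b>] for positive [a] and [b].

    Conversely, let [P] be the projection on [E^+] and suppose [P u = 0], as is
    the case for [u = x - P x].  If [v >= 0] and [v >= - u], then subadditivity
    gives [u + v = P (u + v) <= P u + P v = v], so [u <= 0].  Hence [x <= P x],
    and isotonicity makes [P x] the least positive upper bound of [x].
    For [b >= 0] this yields [P (- b) = 0], hence [<a, b> >= 0] for [a >= 0];
    with [x^+] orthogonal to [x^-] this makes the norm a lattice norm. *)

Require Import Defs.
From mathcomp Require Import all_boot all_order all_algebra.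
From mathcomp Require Import sesquilinear.
From mathcomp Require Import boolp classical_sets reals.
From mathcomp Require Import ring lra.
Import Order.TTheory GRing.Theory Num.Theory.
Local Open Scope ring_scope.

(** * Order calculus, suprema and positive parts *)

Section OrderedVectorSpace.
Context {R : realType} {E : orderedLmodType R}.
Implicit Types x y z p : E.

Lemma ov_subr_ge0 x y : (0 <= y - x) = (x <= y).
Proof.
apply/idP/idP => [/(@ov_leD2r _ _ x)|/(@ov_leD2r _ _ (- x))].
  by rewrite add0r subrK.
by rewrite subrr.
Qed.

Lemma ov_addr_ge0 x y : 0 <= x -> 0 <= y -> 0 <= x + y.
Proof. by move=> x0 /(@ov_leD2r _ _ x); rewrite add0r addrC; apply: le_trans. Qed.

Lemma ov_scaler_ge0 (a : R) x : 0 <= a -> 0 <= x -> 0 <= a *: x.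
Proof. by move=> a0 /(@ov_leZ2l _ _ a _ _ a0); rewrite scaler0. Qed.

Lemma ov_leD x y z t : x <= y -> z <= t -> x + z <= y + t.
Proof.
move=> /(@ov_leD2r _ _ z) xy /(@ov_leD2r _ _ y); rewrite !(addrC _ y).
exact: le_trans.
Qed.

Lemma ov_leN2 x y : (- x <= - y) = (y <= x).
Proof. by rewrite -(ov_subr_ge0 (- x)) opprK addrC ov_subr_ge0. Qed.

Lemma supremums2P x y z : supremums [set x; y]%classic z <->
  [/\ x <= z, y <= z & forall t, x <= t -> y <= t -> z <= t].
Proof.
split=> [[ub lub]|[xz yz lub]].
  split; [by apply: ub; left|by apply: ub; right|].
  by move=> t xt yt; apply: lub => _ [->|->].
by split=> [_ [->|->]//|t ub]; apply: lub; apply: ub; [left|right].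
Qed.

Lemma vjoin_eq x y z : supremums [set x; y]%classic z -> vjoin x y = z.
Proof.
(* [supremum] returns its default on the empty set; the pair contains [x], so that branch is
   excluded. *)
move=> sz; rewrite /vjoin /supremum ifF; last first.
  by apply/negP => /eqP /(congr1 (@^~ x)) /= e; rewrite -[False]e; left.
by apply: xget_unique => // t st; apply: is_subset1_supremums st sz.
Qed.

Lemma supremums2D x y z t : supremums [set x; y]%classic z ->
  supremums [set x + t; y + t]%classic (z + t).
Proof.
move=> /supremums2P[xz yz lub]; apply/supremums2P; split; try exact: ov_leD2r.
move=> s /(@ov_leD2r _ _ (- t)) + /(@ov_leD2r _ _ (- t)); rewrite !addrK.
by move=> h1 h2; have := ov_leD2r t _ _ (lub _ h1 h2); rewrite subrK.
Qed.

(* [(x^+) - x = x^-] *)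
Lemma pos_partN x p : supremums [set x; 0]%classic p ->
  supremums [set - x; 0]%classic (p - x).
Proof. by move=> /(supremums2D _ _ _ (- x)); rewrite subrr add0r setUC. Qed.

(** If [t] bounds both [x] and [- x], then [(x + t) / 2] bounds both [x] and 0, hence dominates [p];
    doubling gives [p + (p - x) <= t]. *)
Lemma pos_part_abs x p : supremums [set x; 0]%classic p ->
  vabs x = p + (p - x).
Proof.
move=> sp; apply: vjoin_eq.
have [xp p0 lub] := (supremums2P _ _ _).1 sp.
have [Nxp q0 _] := (supremums2P _ _ _).1 (pos_partN _ _ sp).
apply/supremums2P; split.
- by rewrite -[leLHS]addr0; apply: ov_leD.
- by rewrite -[leLHS]add0r; apply: ov_leD.
move=> t xt Nxt.
have t2 : 0 <= 2%:R^-1 *: (x + t).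
  by rewrite ov_scaler_ge0 ?invr_ge0 // addrC -(opprK x) ov_subr_ge0.
have xt2 : x <= 2%:R^-1 *: (x + t).
  rewrite -ov_subr_ge0.
  have -> : 2%:R^-1 *: (x + t) - x = 2%:R^-1 *: (t - x).
    rewrite scalerDr scalerBr addrAC -[X in _ - X + _]scale1r -scalerBl.
    by rewrite addrC -scaleNr; congr (_ + _ *: _); field.
  by rewrite ov_scaler_ge0 ?invr_ge0 // ov_subr_ge0.
have /(ov_leZ2l 2%:R _ _ (ler0n _ _)) := lub _ xt2 t2.
rewrite scalerA divff ?pnatr_eq0 // scale1r => /(ov_leD2r (- x)).
by rewrite scaler_nat mulr2n addrA [x + t]addrC addrK.
Qed.

Lemma vabs_ge0 x : 0 <= x -> vabs x = x.
Proof.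
move=> x0; rewrite (pos_part_abs x x) ?subrr ?addr0 //.
by apply/supremums2P; split.
Qed.

Lemma vjoinP : vector_lattice E ->
  forall x y, supremums [set x; y]%classic (vjoin x y).
Proof. by move=> VL x y; have [s /[dup] /vjoin_eq <-] := VL x y. Qed.

Lemma vposP : vector_lattice E -> forall x, supremums [set x; 0]%classic (vpos x).
Proof. by move=> VL x; apply: vjoinP. Qed.

(** Translation by [y] carries the supremum of [x - y] and 0 to that of [x] and [y]. *)
Lemma vector_lattice_pos_part (f : E -> E) :
  (forall x, supremums [set x; 0]%classic (f x)) -> vector_lattice E.
Proof.
move=> fP x y; exists (f (x - y) + y).
by have := supremums2D _ _ _ y (fP (x - y)); rewrite subrK add0r.
Qed.

Lemma vpos_isotone : vector_lattice E -> isotone (@vpos R E).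
Proof.
move=> /vposP VL x y xy.
have [yp p0 _] := (supremums2P _ _ _).1 (VL y).
by have [_ _ ->//] := (supremums2P _ _ _).1 (VL x); apply: le_trans yp.
Qed.

Lemma vpos_subadditive : vector_lattice E -> subadditive (@vpos R E).
Proof.
move=> /vposP VL x y.
have [xp p0 _] := (supremums2P _ _ _).1 (VL x).
have [yq q0 _] := (supremums2P _ _ _).1 (VL y).
have [_ _ ->//] := (supremums2P _ _ _).1 (VL (x + y)).
  exact: ov_leD.
exact: ov_addr_ge0.
Qed.

End OrderedVectorSpace.

(** Nonnegativity of [N] bounds the distances below by 0, so [inf] is their genuine greatest lower
    bound. *)
Lemma best_approxP (R : realType) (E : lmodType R) (N : E -> R)
    (A : set E) (x b : E) : (forall y, 0 <= N y) ->
  best_approx N A x b <-> A b /\ forall a, A a -> N (x - b) <= N (x - a).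
Proof.
move=> N0.
have lb : has_lbound [set N (x - a) | a in A]%classic.
  by exists 0 => _ [a _ <-].
split=> -[Ab H]; split=> //.
  by move=> a Aa; rewrite H; apply: ge_inf => //; exists a.
apply/le_anti/andP; split; last by apply: ge_inf => //; exists b.
by apply: lb_le_inf; [exists (N (x - b)), b|move=> _ [a Aa <-]; apply: H].
Qed.

(** * Inner product identities and the first-order condition for a nearest point *)

Section InnerProduct.
Context {R : realType} {E : lmodType R} (dot : {dot E for (@idfun R)}).
Implicit Types x y : E.

(* The generic [linearDl], etc., rewrite [dot] into a projection path through
   [Bilinear] that the lemmas below would no longer recognize. *)
Lemma dot0l x : dot 0 x = 0. Proof. exact: linear0l. Qed.
Lemma dot0r x : dot x 0 = 0. Proof. exact: linear0r. Qed.
Lemma dotNl x y : dot (- x) y = - dot x y. Proof. exact: linearNl. Qed.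
Lemma dotNr x y : dot x (- y) = - dot x y. Proof. exact: linearNr. Qed.
Lemma dotDl x y z : dot (x + y) z = dot x z + dot y z.
Proof. exact: linearDl. Qed.
Lemma dotDr x y z : dot x (y + z) = dot x y + dot x z.
Proof. exact: linearDr. Qed.
Lemma dotBl x y z : dot (x - y) z = dot x z - dot y z.
Proof. exact: linearBl. Qed.
Lemma dotBr x y z : dot x (y - z) = dot x y - dot x z.
Proof. exact: linearBr. Qed.
Lemma dotZl (a : R) x y : dot (a *: x) y = a * dot x y.
Proof. exact: linearZl_LR. Qed.
Lemma dotZr (a : R) x y : dot x (a *: y) = a * dot x y.
Proof. exact: linearZr_LR. Qed.

Lemma dotC x y : dot x y = dot y x.
Proof. by rewrite hermC /= expr0 mul1r. Qed.

Lemma dotxx_ge0 x : 0 <= dot x x.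
Proof.
by have [->|/neq0_dnorm_gt0/ltW->//] := eqVneq x 0; rewrite dot0l.
Qed.

Lemma dotxx_le0 x : dot x x <= 0 -> x = 0.
Proof.
by move=> h; apply/eqP/negPn/negP => /(@neq0_dnorm_gt0 _ _ _ dot); rewrite ltNge h.
Qed.

Lemma dotDD x y : dot (x + y) (x + y) = dot x x + 2 * dot x y + dot y y.
Proof. by rewrite dotDl !dotDr (dotC y x); ring. Qed.

Lemma dotBB x y : dot (x - y) (x - y) = dot x x - 2 * dot x y + dot y y.
Proof. by rewrite dotBl !dotBr (dotC y x); ring. Qed.

Lemma dot_norm_le x y : (dot_norm dot x <= dot_norm dot y) = (dot x x <= dot y y).
Proof. by rewrite ler_sqrt // dotxx_ge0. Qed.

Lemma dot_nearest_direction x b v :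
  (forall t : R, 0 < t <= 1 ->
    dot (x - b) (x - b) <= dot (x - (b + t *: v)) (x - (b + t *: v))) ->
  dot (x - b) v <= 0.
Proof.
move=> H; rewrite leNgt; apply/negP; set c := dot (x - b) v => c0.
have q0 := dotxx_ge0 v.
(* Expanding the square, minimality reads [2 * c <= t * dot v v]. The step [t = c / d] lies in (0,
   1] even if [v = 0], and gives [t * dot v v <= t * d = c < 2 * c], a contradiction. *)
pose d := c + dot v v.
have d0 : 0 < d by rewrite /d; lra.
have t01 : 0 < c / d <= 1.
  by rewrite divr_gt0 //= ler_pdivrMr // mul1r /d; lra.
have := H _ t01; rewrite opprD addrA (dotBB (x - b)).
rewrite dotZr dotZl dotZr -/c.
have e : c / d * d = c by rewrite divfK // gt_eqF.
move: (c / d) t01 e => t /andP[t0 _] e.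
have : t * dot v v <= c by rewrite -e ler_wpM2l ?ltW // /d; lra.
nra.
Qed.

End InnerProduct.

(** * Best approximation in the positive cone *)

Section PositiveCone.
Context {R : realType} {E : orderedLmodType R} (dot : {dot E for (@idfun R)}).
Implicit Types x y b : E.

Local Notation K := (@pos_cone R E).
Local Notation approx := (best_approx (dot_norm dot) K).
Local Notation P := (metric_proj (dot_norm dot) K).

Lemma best_approx_coneP x b : approx x b <->
  [/\ 0 <= b, dot (x - b) b = 0 & forall k, 0 <= k -> dot (x - b) k <= 0].
Proof.
rewrite best_approxP; last by move=> y; rewrite sqrtr_ge0.
split=> [[b0 bP]|[b0 xb xk]].
  have H v : (forall t : R, 0 < t <= 1 -> 0 <= b + t *: v) -> dot (x - b) v <= 0.
    move=> Kv; apply: dot_nearest_direction => t /Kv bt0.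
    by rewrite -dot_norm_le; apply: bP.
  have Hk k : 0 <= k -> dot (x - b) k <= 0.
    move=> k0; apply: H => t /andP[t0 _].
    by rewrite ov_addr_ge0 // ov_scaler_ge0 // ltW.
  (* Orthogonality comes from the two directions [b] and [- b]; the latter stays in the cone because
     [t <= 1] makes [(1 - t) *: b] positive. *)
  split=> //; apply/le_anti; rewrite Hk //= -oppr_le0 -dotNr.
  apply: H => t /andP[_ t1].
  by rewrite scalerN -[b in b - _]scale1r -scalerBl ov_scaler_ge0 // subr_ge0.
split=> // k k0; rewrite dot_norm_le.
have -> : x - k = (x - b) + (b - k) by rewrite addrA subrK.
rewrite [leRHS]dotDD dotBr xb.
have := xk k k0; have := dotxx_ge0 dot (b - k); lra.
Qed.

(** The squared norm of [b - c] expands to [dot (x - c) b + dot (x - b) c], and both terms are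
    nonpositive. *)
Lemma best_approx_cone_inj x b c : approx x b -> approx x c -> b = c.
Proof.
move=> /best_approx_coneP[b0 xb xbK] /best_approx_coneP[c0 xc xcK].
apply/eqP; rewrite -subr_eq0; apply/eqP/(dotxx_le0 dot).
have {1}-> : b - c = (x - c) - (x - b) by rewrite opprB [RHS]addrC addrA subrK.
rewrite dotBl !dotBr xb xc.
by have := xbK c c0; have := xcK b b0; lra.
Qed.

Lemma metric_proj_eq x b : approx x b -> P x = b.
Proof.
by move=> xb; apply: xget_unique => // c xc; apply: best_approx_cone_inj xc xb.
Qed.

Lemma chebyshev_cone (f : E -> E) :
  (forall x, approx x (f x)) -> chebyshev (dot_norm dot) K.
Proof.
move=> fP; split=> [|x]; first by exists 0; apply: lexx.
by exists (f x); split=> // c xc; apply: best_approx_cone_inj (fP x) xc.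
Qed.

Lemma inner_product_lattice_dot_ge0 x y : inner_product_lattice dot ->
  0 <= x -> 0 <= y -> 0 <= dot x y.
Proof.
move=> [VL LN] x0 y0.
have le_abs : vabs (x - y) <= vabs (x + y).
  rewrite (vabs_ge0 (x + y)) ?ov_addr_ge0 //.
  have [_ _ ->//] := (supremums2P _ _ _).1 (vjoinP VL (x - y) (- (x - y))).
    by apply: ov_leD => //; rewrite -ov_subr_ge0 opprK ov_addr_ge0.
  by rewrite opprB addrC ov_leD // -ov_subr_ge0 opprK ov_addr_ge0.
have := LN _ _ le_abs; rewrite dot_norm_le dotBB dotDD; lra.
Qed.

Lemma inner_product_lattice_approx x : inner_product_lattice dot ->
  approx x (vpos x).
Proof.
move=> IL; have [VL LN] := IL.
have sp := vposP VL x; move: (vpos x) sp => p sp.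
have [_ p0 _] := (supremums2P _ _ _).1 sp.
have [_ q0 _] := (supremums2P _ _ _).1 (pos_partN _ _ sp).
have dot_ge0 := inner_product_lattice_dot_ge0 _ _ IL.
have xpE : x - p = - (p - x) by rewrite opprB.
apply/best_approx_coneP; split=> // [|k k0]; rewrite xpE dotNl; last first.
  by rewrite oppr_le0 dot_ge0.
apply/eqP; rewrite oppr_eq0 dotC eq_le dot_ge0 // andbT.
(* Both sides equal the absolute value of [x]. Writing [q = p - x], the lattice norm then puts the
   norm of [p + q] below that of [p - q], so [dot p q <= 0]. *)
have le_abs : vabs (p + (p - x)) <= vabs x.
  by rewrite vabs_ge0 ?(pos_part_abs _ _ sp) ?lexx // ov_addr_ge0.
have := LN _ _ le_abs; rewrite dot_norm_le.
have {3 4}-> : x = p - (p - x) by rewrite opprB addrC subrK.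
by rewrite dotBB dotDD; lra.
Qed.

(** * Recovering the lattice structure from the projection *)

Section Projection.
Hypothesis hE : directed E.
Hypothesis chebK : chebyshev (dot_norm dot) K.
Hypothesis isoP : isotone P.
Hypothesis subP : subadditive P.

Lemma metric_projP x : approx x (P x).
Proof. by have [_ /(_ x)[b [xb _]]] := chebK; apply: xgetI xb. Qed.

Lemma metric_proj_id x : 0 <= x -> P x = x.
Proof.
move=> x0; apply/metric_proj_eq/best_approx_coneP.
by rewrite subrr dot0l; split=> // k _; rewrite dot0l.
Qed.

Lemma metric_proj_eq0_le0 x : P x = 0 -> x <= 0.
Proof.
(* Directedness supplies [v] such that [v] and [x + v] both lie in the cone, where [P] is the
   identity. *)
move=> Px0; have [v [xv v0]] := hE (- x) 0.
have xv0 : 0 <= x + v by rewrite addrC -[x]opprK ov_subr_ge0.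
have := subP x v; rewrite Px0 add0r !metric_proj_id // -ov_subr_ge0.
by rewrite opprD addrCA subrr addr0 -sub0r ov_subr_ge0.
Qed.

Lemma metric_proj_pos_part x : supremums [set x; 0]%classic (P x).
Proof.
have [p0 xp xpK] := (best_approx_coneP _ _).1 (metric_projP x).
apply/supremums2P; split=> // [|t xt t0].
  (* For the candidate 0 orthogonality is trivial, and the remaining condition is [xpK]. *)
  have /metric_proj_eq0_le0 : P (x - P x) = 0.
    by apply/metric_proj_eq/best_approx_coneP; rewrite subr0 dot0r.
  by rewrite -ov_subr_ge0 sub0r opprB ov_subr_ge0.
by have := isoP x t xt; rewrite (metric_proj_id t).
Qed.

Lemma metric_proj_dot_ge0 x y : 0 <= x -> 0 <= y -> 0 <= dot x y.
Proof.
move=> x0 y0.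
have Px0 : P (- x) = 0.
  have [_ P0 lub] := (supremums2P _ _ _).1 (metric_proj_pos_part (- x)).
  by apply/le_anti; rewrite P0 lub // -oppr0 ov_leN2.
have [_ _ /(_ y y0)] := (best_approx_coneP _ _).1 (metric_projP (- x)).
by rewrite Px0 subr0 dotNl oppr_le0.
Qed.

(** By Pythagoras: [p = P x] is orthogonal to [p - x], so their sum and their difference have equal
    norms. *)
Lemma metric_proj_dot_abs x : dot (vabs x) (vabs x) = dot x x.
Proof.
have sp := metric_proj_pos_part x.
have [_ xp _] := (best_approx_coneP _ _).1 (metric_projP x).
rewrite (pos_part_abs _ _ sp); move: (P x) xp => p xp.
have qp : dot p (p - x) = 0 by rewrite dotC -opprB dotNl xp oppr0.
have -> : dot x x = dot (p - (p - x)) (p - (p - x)) by rewrite opprB addrC subrK.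
by rewrite (dotBB _ p) (dotDD _ p (p - x)) qp; ring.
Qed.

Lemma metric_proj_lattice : inner_product_lattice dot.
Proof.
split; first exact: vector_lattice_pos_part metric_proj_pos_part.
move=> x y xy; rewrite dot_norm_le -(metric_proj_dot_abs x) -(metric_proj_dot_abs y).
have abs0 (z : E) : 0 <= vabs z.
  have sp := metric_proj_pos_part z.
  have [_ p0 _] := (supremums2P _ _ _).1 sp.
  have [_ q0 _] := (supremums2P _ _ _).1 (pos_partN _ _ sp).
  by rewrite (pos_part_abs _ _ sp) ov_addr_ge0.
move: (vabs x) (vabs y) (abs0 x) (abs0 y) xy => a b a0 b0.
rewrite -ov_subr_ge0 => ab0.
(* In the expanded square of [a + (b - a)] the cross term is nonnegative, since both summands are
   positive. *)
have -> : b = a + (b - a) by rewrite addrC subrK.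
rewrite [leRHS]dotDD; have := dotxx_ge0 dot (b - a).
have := metric_proj_dot_ge0 _ _ a0 ab0; lra.
Qed.

End Projection.
End PositiveCone.

Theorem theorem4 (R : realType) (E : orderedLmodType R)
    (dot : {dot E for (@idfun R)}) (hE : directed E) :
  (inner_product_lattice dot <->
     [/\ chebyshev (dot_norm dot) (@pos_cone R E),
         isotone (metric_proj (dot_norm dot) (@pos_cone R E))
       & subadditive (metric_proj (dot_norm dot) (@pos_cone R E))]) /\
  (inner_product_lattice dot ->
     forall x : E, metric_proj (dot_norm dot) (@pos_cone R E) x = vpos x).
Proof.
have projE : inner_product_lattice dot ->
    forall x : E, metric_proj (dot_norm dot) (@pos_cone R E) x = vpos x.
  by move=> IL x; apply/metric_proj_eq/inner_product_lattice_approx.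
split=> //; split=> [IL|[]]; last exact: metric_proj_lattice.
(* Isotonicity and subadditivity thereby become purely order-theoretic facts about positive
   parts. *)
have -> : metric_proj (dot_norm dot) (@pos_cone R E) = @vpos R E.
  by apply/funext => x; apply: projE.
have [VL _] := IL; split.
- exact: (chebyshev_cone _ _ (fun x => inner_product_lattice_approx _ x IL)).
- exact: vpos_isotone.
- exact: vpos_subadditive.
Qed.
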